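(* Let $\mathbf X=(X_t)_{t\ge0}\in\mathcal G$ be a chain on $\{0,1\}^N$ with associated parameters $p\ge q=1-p$ and associated independent random vectors $(Z_k)_{k\ge1}$. For $x,y\in\{0,1\}^N$, $j\in[N]$, $t\ge1$ put $$S^{(t)}[x,y,j]=x[j]+y[j]-1+\sum_{k=1}^tZ_k[j].$$ Then $$P_t(y\mid x)=\pi(y,p)\,\mathbb E\left[\prod_{j=1}^N\left(1-\left(-\frac qp\right)^{S^{(t)}[x,y,j]}\right)\right],\qquad( * )$$ and moreover $$\|P_t(\cdot\mid x)-\pi(\cdot,p)\|_{TV}=\frac12\sum_{y\in\{0,1\}^N}\pi(y,p)\left|\mathbb E\left[\prod_{j=1}^N\left(1-\left(-\frac qp\right)^{S^{(t)}[x,y,j]}\right)\right]-1\right|.$$ Vice versa, if $(Z_k)_{k\ge1}$ are independent random vectors in $\{0,1\}^N$, then the process with transition functions defined by $( * )$ belongs to $\mathcal G$.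
   Context: Let $\mathcal V_N=\{0,1\}^N$ and $[N]=\{1,\dots,N\}$. For $y\in\mathcal V_N$ write $y=(y[1],\dots,y[N])$, $\|y\|=\sum_j y[j]$, and $y(B)=(y[j])_{j\in B}$ for $B\subseteq[N]$. For $p\in[1/2,1)$ put $q=1-p$ and $\pi(y,p)=p^{\|y\|}q^{N-\|y\|}$. The class $\mathcal G$ consists of the reversible Markov chains $\mathbf X=(X_t)_{t\ge0}$, not necessarily time-homogeneous, with state space $\mathcal V_N$ for some $N$, such that: (1) there is a parameter $p\ge 1/2$ such that $\pi(\cdot,p)$ is the unique stationary measure of $\mathbf X$ (reversibility is with respect to it; in the inhomogeneous case each one-step kernel is reversible with respect to it); (2) for all $t\ge1$, all $B\subseteq[N]$ and all $C\subseteq\{0,1\}^B$, $\mathbb P(X_t(B)\in C\mid X_{t-1})=\mathbb P(X_t(B)\in C\mid X_{t-1}(B))$, i.e. the conditional law of $X_t(B)$ given $X_{t-1}=x$ depends on $x$ only through $x(B)$. For $\mathbf X\in\mathcal G$, $(Z_t)_{t\ge1}$ is a sequence of independent random vectors in $\mathcal V_N$ with $\mathbb P(Z_t\in S)=\mathbb P(X_t\in S\mid X_{t-1}=\mathbf 0)$, $\mathbf 0=(0,\dots,0)$. $P_t(y\mid x)=\mathbb P(X_t=y\mid X_0=x)$, and $\|\mu-\nu\|_{TV}=\max_A|\mu(A)-\nu(A)|$.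
   Formalization: The converse fails if e.g. all Z_k=0 (identity kernel, stationary measure not unique); here the process has all properties of G except uniqueness, and lies in G iff for each nonempty B some t≥1 has E[∏_{j∈B}(-q/p)^{Z_t[j]}]≠1. *)

(* Defs.v *)
From HB Require Import structures.
From mathcomp Require Import all_boot all_order all_algebra.
From mathcomp Require Import all_classical all_reals all_analysis.

Set Implicit Arguments.
Unset Strict Implicit.
Unset Printing Implicit Defensive.

Import Order.TTheory GRing.Theory Num.Theory.
Local Open Scope classical_set_scope.
Local Open Scope ring_scope.

(* Coordinates are indexed by 0, ..., N-1 instead of 1, ..., N. *)
Definition cube (N : nat) : Type := {ffun 'I_N -> bool}.

HB.instance Definition _ (N : nat) := Finite.on (cube N).
HB.instance Definition _ (N : nat) :=
  isPointed.Build (cube N) [ffun => false].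
(* [cube N] carries the discrete sigma-algebra. *)
HB.instance Definition _ (N : nat) :=
  @isMeasurable.Build default_measure_display (cube N)
    discrete_measurable discrete_measurable0
    discrete_measurableC discrete_measurableU.

Definition coord (N : nat) (y : cube N) (j : 'I_N) : bool :=
  (y : {ffun 'I_N -> bool}) j.

Definition cube0 (N : nat) : cube N := [ffun => false].

Definition hweight (N : nat) (y : cube N) : nat := (\sum_(j < N) coord y j)%N.

Definition restr (N : nat) (B : {set 'I_N}) (y : cube N) :
    {ffun {j : 'I_N | j \in B} -> bool} :=
  [ffun j => coord y (val j)].

Definition bern (R : realType) (N : nat) (p : R) (y : cube N) : R :=
  p ^+ hweight y * (1 - p) ^+ (N - hweight y).

(* A possibly time-inhomogeneous Markov chain with finite state space,
   presented by its one-step kernels: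
   [step X t x y] is P(X_{t+1} = y | X_t = x). *)
Record markov_chain (R : realType) (V : finType) := MarkovChain {
  step : nat -> V -> V -> R;
  step_ge0 : forall t x y, 0 <= step t x y;
  step_sum1 : forall t x, \sum_y step t x y = 1 }.

Section MarkovChains.
Context {R : realType} {V : finType}.
Implicit Types (X : markov_chain R V) (mu nu : V -> R).

(* P(X_{s+n} = y | X_s = x) *)
Fixpoint trans_after X (s n : nat) (x y : V) : R :=
  if n is m.+1 then \sum_z trans_after X s m x z * step X (s + m) z y
  else (x == y)%:R.

(* P(X_t = y | X_s = x), for s <= t *)
Definition trans X (s t : nat) : V -> V -> R := trans_after X s (t - s).

Definition is_distr mu : Prop := (forall x, 0 <= mu x) /\ \sum_x mu x = 1.

Definition stationary X mu : Prop :=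
  is_distr mu /\ forall t y, \sum_x mu x * step X t x y = mu y.

Definition unique_stationary X mu : Prop :=
  stationary X mu /\ forall nu, stationary X nu -> nu =1 mu.

Definition reversible X mu : Prop :=
  forall t x y, mu x * step X t x y = mu y * step X t y x.

Definition tv_dist mu nu : R :=
  \big[Num.max/0]_(A : {set V}) `|\sum_(y in A) mu y - \sum_(y in A) nu y|.

End MarkovChains.

(* The conditional law of X_{t+1}(B) given X_t = x depends on x only through
   x(B). *)
Definition autonomous (R : realType) (N : nat)
    (X : markov_chain R (cube N)) : Prop :=
  forall (t : nat) (B : {set 'I_N})
      (C : {set {ffun {j : 'I_N | j \in B} -> bool}}) (x x' : cube N),
    restr B x = restr B x' ->
    \sum_(y | restr B y \in C) step X t x y =
    \sum_(y | restr B y \in C) step X t x' y.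

(* [X] belongs to the class G, with associated parameter [p]. *)
Definition class_G (R : realType) (N : nat) (X : markov_chain R (cube N))
    (p : R) : Prop :=
  [/\ 2^-1 <= p < 1, unique_stationary X (bern p), reversible X (bern p)
    & autonomous X].

Definition mutually_independent {d d' : measure_display}
    {T : measurableType d} {T' : measurableType d'} {R : realType}
    (P : probability T R) {I : choiceType} (D : set I)
    (Z : I -> {RV P >-> T'}) : Prop :=
  forall (J : seq I) (A : I -> set T'),
    uniq J -> [set` J] `<=` D -> (forall i, measurable (A i)) ->
    P (\bigcap_(i in [set` J]) (Z i @^-1` A i)) =
    (\prod_(i <- J) P (Z i @^-1` A i))%E.

Section CubeVectors.
Context {d : measure_display} {T : measurableType d} {R : realType}.
Context {P : probability T R} {N : nat}.

(* The random vectors are Z_1, Z_2, ...: [Z 0] is never used. *)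
Implicit Type Z : nat -> {RV P >-> cube N}.

Definition independent_vectors Z : Prop :=
  mutually_independent [set k | (0 < k)%N] Z.

Definition associated (X : markov_chain R (cube N)) Z : Prop :=
  forall (t : nat) (S : {set cube N}),
    P (Z t.+1 @^-1` [set` S]) = (\sum_(z in S) step X t (cube0 N) z)%:E.

(* x[j] + y[j] - 1 + Z_{s+1}[j] + ... + Z_t[j]; it can be equal to -1. *)
Definition Sexp Z (s t : nat) (x y : cube N) (j : 'I_N) (w : T) : int :=
  (coord x j)%:Z + (coord y j)%:Z - 1
  + \sum_(s.+1 <= k < t.+1) (coord (Z k w) j)%:Z.

(* The integrands below take finitely many values, so [fine] loses nothing. *)
Definition Eprod (p : R) Z (s t : nat) (x y : cube N) : R :=
  fine 'E_P[fun w => \prod_(j < N)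
    (1 - (- ((1 - p) / p)) ^ Sexp Z s t x y j w)].

(* For every nonempty B, some Z_t does not fix the eigenfunction
   x |-> \prod_(j in B) (- q / p) ^ x[j] of the chain built from (Z_k).
   E.g. if Z_t = 0 almost surely for all t, that chain never moves, and every
   distribution is stationary. *)
Definition moving_vectors (p : R) Z : Prop :=
  forall B : {set 'I_N}, B != finset.set0 ->
    exists t : nat, (0 < t)%N /\
      fine 'E_P[fun w => \prod_(j in B)
        (- ((1 - p) / p)) ^+ coord (Z t w) j] != 1.

End CubeVectors.

(* Main.v *)
From mathcomp Require Import all_boot all_order all_algebra.
From mathcomp Require Import all_classical all_reals all_analysis.
From mathcomp Require Import ring lra.
Require Import Defs.

Set Implicit Arguments.
Unset Strict Implicit.
Unset Printing Implicit Defensive.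

Import Order.TTheory GRing.Theory Num.Theory.
Local Open Scope ring_scope.

(** The proof is harmonic analysis on the cube. Put q = 1 - p and
    theta = - q / p, and for a set B of coordinates let
    walsh B x = \prod_(j in B) theta ^+ x[j]. Since q + p theta = 0, each
    factor has mean zero under the Bernoulli weight, so the functions walsh B
    form an orthogonal basis of L^2(bern p), and the squared norm of walsh B is
    (q / p) ^ #|B| ([walsh_orthogonal], [walsh_complete]).

    A kernel that is reversible and acts autonomously on every set of
    coordinates is diagonal in this basis. Autonomy says that the image of
    walsh B is a function of the coordinates in B, hence orthogonal to walsh A
    unless A is contained in B; reversibility makes the kernel self-adjoint,
    which exchanges A and B and leaves only A = B ([autonomous_spectral]).
    The eigenvalue is read off at the zero vertex, where every walsh B equals
    1: it is the mean of walsh B over the law of one step from 0, i.e. over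
    the law of Z_k. Conversely every kernel that is diagonal in this basis is
    reversible and autonomous.

    Composing kernels multiplies eigenvalues, and by independence the product
    of the means of walsh B (Z_k) is the mean of the product. On the other
    side, - theta ^-1 = p / q, so each factor of the integrand is
    1 - theta ^ (x[j] + y[j] - 1 + sum_k Z_k[j])
      = 1 + (p / q) theta ^ x[j] theta ^ y[j] \prod_k theta ^ Z_k[j],
    and expanding the product over j as a sum over sets B gives exactly the
    diagonal kernel with those eigenvalues ([EprodE]). The total variation
    formula is then half of the l^1 distance.

    For the converse, a one-step kernel given by the formula is nonnegative
    because the exponents are at least -1 and - theta lies in [0, 1], and it
    sums to 1 because the eigenvalue of walsh set0 is 1. A stationary measure
    nu has \sum_x nu x * walsh B x = 0 as soon as some step has an eigenvalue
    different from 1 at B; if this happens for all nonempty B then nu = bern p,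
    and if it fails at B then bern p * (1 + walsh B) is another stationary
    distribution ([spectral_unique_stationary]). *)

(** * The eigenbasis of the biased cube *)

Section Walsh.
Context {R : realType} {N : nat} (p : R) (p01 : 0 < p < 1).
Implicit Types (A B : {set 'I_N}) (x y z : cube N) (f g : cube N -> R).
Implicit Types lam mu : {set 'I_N} -> R.

Let p_gt0 : 0 < p. Proof. by case/andP: p01. Qed.
Let q_gt0 : 0 < 1 - p. Proof. by rewrite subr_gt0; case/andP: p01. Qed.
Let p_neq0 : p != 0. Proof. by rewrite gt_eqF. Qed.
Let q_neq0 : 1 - p != 0. Proof. by rewrite gt_eqF. Qed.

Definition theta : R := - ((1 - p) / p).

Definition walsh B x : R := \prod_(j in B) theta ^+ coord x j.

(** The inverse of the squared norm of [walsh B] in L^2(bern p). *)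
Definition walsh_scale B : R := (p / (1 - p)) ^+ #|B|.

Definition local_to B f := forall x y, restr B x = restr B y -> f x = f y.

Lemma bern_prod x : bern p x = \prod_(j < N) (if coord x j then p else 1 - p).
Proof.
rewrite /bern [RHS](bigID (fun j => coord x j)) /=.
rewrite (eq_bigr (fun=> p)); last by move=> j ->.
rewrite [X in _ = _ * X](eq_bigr (fun=> 1 - p)); last by move=> j /negPf ->.
have hw : hweight x = #|(fun j => coord x j) : pred _|.
  rewrite /hweight -sum1_card [RHS]big_mkcond; apply: eq_bigr => j _.
  by rewrite unfold_in; case: coord.
rewrite !prodr_const -hw; congr (_ * _ ^+ _); rewrite hw.
apply/esym/(canRL (addKn _)); rewrite -[RHS]card_ord.
by rewrite -(cardC (fun j => coord x j)); congr (_ + _)%N; apply: eq_card.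
Qed.

Lemma bern_gt0 x : 0 < bern p x.
Proof. by rewrite bern_prod; apply: prodr_gt0 => j _; case: coord. Qed.

Lemma restr_coord B x y j : restr B x = restr B y -> j \in B ->
  coord x j = coord y j.
Proof.
move=> e jB; move: (congr1 (fun u : {ffun _ -> bool} => u (exist _ j jB)) e).
by rewrite /restr !ffunE.
Qed.

Lemma walsh_local B : local_to B (walsh B).
Proof.
by move=> x y e; apply: eq_bigr => j jB; rewrite (restr_coord e jB).
Qed.

Lemma local_sub A B f : A \subset B -> local_to A f -> local_to B f.
Proof.
move=> /fintype.subsetP AB hf x y e; apply: hf; apply/ffunP => -[j jA].
by rewrite !ffunE /= (restr_coord e (AB _ jA)).
Qed.

Lemma walsh0 x : walsh finset.set0 x = 1.
Proof. by rewrite /walsh big_set0. Qed.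

Lemma walsh_cube0 B : walsh B (cube0 N) = 1.
Proof. by rewrite /walsh big1 // => j _; rewrite /coord ffunE. Qed.

Definition flip (i : 'I_N) x : cube N := [ffun j => coord x j (+) (j == i)].

Lemma coord_flip i x j : coord (flip i x) j = coord x j (+) (j == i).
Proof. by rewrite {1}/coord ffunE. Qed.

Lemma flipK i : involutive (flip i).
Proof.
by move=> x; apply/ffunP => j; rewrite -[LHS]/(coord _ j) !coord_flip addbK.
Qed.

(** Flipping one coordinate of B is an antisymmetry of the signed measure
    [bern p * walsh B], because [p * theta = - (1 - p)]; every cancellation
    below comes from it. *)
Lemma bern_walsh_flip B x j : j \in B ->
  bern p (flip j x) * walsh B (flip j x) = - (bern p x * walsh B x).
Proof.
move=> jB; rewrite !bern_prod /walsh ![\prod_(i in B) _]big_mkcond -!big_split.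
rewrite (bigD1 j) // [in RHS](bigD1 j) //= -mulNr; congr (_ * _).
  rewrite jB coord_flip eqxx addbT /theta.
  by case: (coord x j); rewrite /= !expr0 !expr1; field.
by apply: eq_bigr => i /negPf ij; rewrite coord_flip ij addbF.
Qed.

(** Flipping a coordinate in A but not in B keeps f and changes the sign of
    [bern p * walsh A]. *)
Lemma local_orthogonal A B f : local_to B f -> ~~ (A \subset B) ->
  \sum_x bern p x * f x * walsh A x = 0.
Proof.
move=> hf /fintype.subsetPn[j jA jB].
(* S is equal to its opposite, by the change of variable x -> flip j x. *)
set S := \sum_x _; suff: S = - S by lra.
rewrite {1}/S (reindex_inj (inv_inj (flipK j))) -sumrN; apply: eq_bigr => x _.
have -> : f (flip j x) = f x.
  apply: hf; apply/ffunP => -[i iB]; rewrite !ffunE /= coord_flip.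
  have [ij|] := eqVneq i j; last by rewrite addbF.
  by rewrite -ij iB in jB.
by rewrite mulrAC bern_walsh_flip // mulNr mulrAC.
Qed.

(** The sum over B is the expansion of the product over j of
    [p / (1 - p) * theta ^+ (x j + y j) + 1]; a factor vanishes where x and y
    differ, and is the inverse of the weight of y j where they agree. *)
Lemma walsh_complete x y :
  bern p y * (\sum_B walsh_scale B * walsh B x * walsh B y) = (x == y)%:R.
Proof.
have -> : \sum_B walsh_scale B * walsh B x * walsh B y =
    \prod_(j < N) (p / (1 - p) * theta ^+ coord x j * theta ^+ coord y j + 1).
  rewrite bigA_distr; apply: eq_big => [B|B _]; first by rewrite inE.
  by rewrite -big_mkcond /walsh_scale -prodr_const -!big_split.
rewrite bern_prod -big_split /=; case: eqP => [->|xy].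
  apply: big1 => j _; rewrite /theta.
  by case: (coord y j); rewrite /= ?expr0 ?expr1; field;
    rewrite ?p_neq0 ?q_neq0.
have [j xyj] : exists j, coord x j != coord y j.
  apply: contrapT => h; apply: xy; apply/ffunP => j.
  by apply: contrapT => xyj; apply: h; exists j; apply/eqP.
rewrite (bigD1 j) //= [X in X * _](_ : _ = 0) ?mul0r //.
case: (coord x j) (coord y j) xyj => -[] //= _; rewrite /theta ?expr0 ?expr1;
  by field; rewrite ?p_neq0 ?q_neq0.
Qed.

Lemma walsh_expansion f x :
  f x = \sum_A walsh_scale A * (\sum_y bern p y * f y * walsh A y) * walsh A x.
Proof.
transitivity (\sum_y f y * (x == y)%:R).
  rewrite (bigD1 x) //= eqxx mulr1 big1 ?addr0 // => y /negPf.
  by rewrite eq_sym => ->; rewrite mulr0.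
under eq_bigr do rewrite -walsh_complete mulrA mulr_sumr.
rewrite exchange_big; apply: eq_bigr => A _; rewrite mulr_sumr mulr_suml.
by apply: eq_bigr => y _; ring.
Qed.

(** Distinct sets are not mutually included, so [local_orthogonal] applies to
    one of them; the norm then follows by expanding [walsh A] at the zero
    vertex, without computing it. *)
Lemma walsh_orthogonal A B :
  walsh_scale B * (\sum_y bern p y * walsh A y * walsh B y) = (A == B)%:R.
Proof.
have orth C : C != A -> \sum_y bern p y * walsh A y * walsh C y = 0.
  rewrite finset.eqEsubset negb_and => /orP[h|h].
    exact: local_orthogonal (@walsh_local A) h.
  under eq_bigr do rewrite mulrAC.
  exact: local_orthogonal (@walsh_local C) h.
have [<-|AB] := eqVneq A B; last by rewrite orth ?mulr0 // eq_sym.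
have := walsh_expansion (walsh A) (cube0 N).
rewrite [X in _ = X](bigD1 A) //= [X in _ = _ + X]big1 => [|C CA]; last first.
  by rewrite orth // mulr0 mul0r.
by rewrite !walsh_cube0 mulr1 addr0 => <-.
Qed.

(** The kernel with eigenvalue [lam B] at [walsh B]. *)
Definition spectral lam x y : R :=
  bern p y * (\sum_B lam B * walsh_scale B * walsh B x * walsh B y).

Lemma spectral1 x y : spectral (fun=> 1) x y = (x == y)%:R.
Proof.
rewrite -walsh_complete; congr (_ * _).
by apply: eq_bigr => B _; rewrite mul1r.
Qed.

Lemma spectralE lam f x : \sum_y spectral lam x y * f y =
  \sum_B lam B * (walsh_scale B * (\sum_y bern p y * f y * walsh B y))
    * walsh B x.
Proof.
under eq_bigr do rewrite /spectral mulr_sumr mulr_suml.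
rewrite exchange_big; apply: eq_bigr => B _.
rewrite mulr_sumr mulr_sumr mulr_suml.
by apply: eq_bigr => y _; ring.
Qed.

Lemma spectral_eigen lam A x :
  \sum_y spectral lam x y * walsh A y = lam A * walsh A x.
Proof.
rewrite spectralE (bigD1 A) //= walsh_orthogonal eqxx mulr1 big1 ?addr0 //.
by move=> B /negPf; rewrite eq_sym walsh_orthogonal => ->; rewrite mulr0 mul0r.
Qed.

Lemma eigen_spectral (K : cube N -> cube N -> R) lam :
  (forall B x, \sum_y K x y * walsh B y = lam B * walsh B x) ->
  forall x y, K x y = spectral lam x y.
Proof.
move=> hK x y.
transitivity (\sum_z K x z * (z == y)%:R).
  rewrite (bigD1 y) //= eqxx mulr1 big1 ?addr0 // => z /negPf ->.
  by rewrite mulr0.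
under eq_bigr do rewrite -walsh_complete mulrCA mulr_sumr.
rewrite -mulr_sumr exchange_big; congr (_ * _); apply: eq_bigr => B _.
transitivity (lam B * walsh B x * (walsh_scale B * walsh B y)); last by ring.
rewrite -hK mulr_suml.
by apply: eq_bigr => z _; ring.
Qed.

Lemma spectral_comp lam mu x y :
  \sum_z spectral lam x z * spectral mu z y =
  spectral (fun B => lam B * mu B) x y.
Proof.
move: x y; apply: eigen_spectral => B x.
under eq_bigr do rewrite mulr_suml.
rewrite exchange_big /=.
under eq_bigr => z _.
  under eq_bigr do rewrite -mulrA.
  by rewrite -mulr_sumr spectral_eigen mulrCA; over.
by rewrite -mulr_sumr spectral_eigen; ring.
Qed.

Lemma spectral_sum1 lam x : lam finset.set0 = 1 -> \sum_y spectral lam x y = 1.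
Proof.
move=> l0; transitivity (\sum_y spectral lam x y * walsh finset.set0 y).
  by apply: eq_bigr => y _; rewrite walsh0 mulr1.
by rewrite spectral_eigen l0 walsh0 mulr1.
Qed.

Lemma spectral_reversible lam x y :
  bern p x * spectral lam x y = bern p y * spectral lam y x.
Proof.
rewrite /spectral mulrCA; congr (_ * (_ * _)).
by apply: eq_bigr => B _; rewrite mulrAC.
Qed.

(** Only the components [walsh A] of f with A included in B survive, and these
    depend on the coordinates in B. *)
Lemma spectral_local lam B f : local_to B f ->
  local_to B (fun x => \sum_y spectral lam x y * f y).
Proof.
move=> hf x x' e; rewrite !spectralE; apply: eq_bigr => A _.
have [AB|AB] := boolP (A \subset B).
  by congr (_ * _); apply: (local_sub AB (@walsh_local A)).
by rewrite (local_orthogonal hf AB) !mulr0 !mul0r.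
Qed.

End Walsh.

(** * Markov chains on finite sets *)

(** The maximum is reached at the set where mu >= nu: the difference has total
    mass zero, so a set and its complement give opposite values. *)
Lemma tv_dist_half_sum (R : realType) (V : finType) (mu nu : V -> R) :
  \sum_y mu y = \sum_y nu y ->
  tv_dist mu nu = 2^-1 * \sum_y `|mu y - nu y|.
Proof.
move=> munu; pose D (y : V) := mu y - nu y.
have sumD (A : {set V}) : \sum_(y in A) D y = - \sum_(y | y \notin A) D y.
  have : \sum_y D y = 0 by rewrite sumrB munu subrr.
  by rewrite (bigID [in A]) /= => /eqP; rewrite addr_eq0 => /eqP.
have absD (A : {set V}) : \sum_y `|D y| =
    \sum_(y in A) `|D y| + \sum_(y | y \notin A) `|D y|.
  by rewrite (bigID [in A]).
rewrite /tv_dist; apply/eqP; rewrite eq_le; apply/andP; split.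
  apply: bigmax_le => [|A _]; first by rewrite mulr_ge0 ?sumr_ge0 ?invr_ge0.
  rewrite -sumrB -/D (absD A).
  have h1 : `|\sum_(y in A) D y| <= \sum_(y in A) `|D y| by exact: ler_norm_sum.
  have h2 : `|\sum_(y in A) D y| <= \sum_(y | y \notin A) `|D y|.
    by rewrite sumD normrN; exact: ler_norm_sum.
  by lra.
pose A := [set y | 0 <= D y]%SET.
apply: le_trans (le_bigmax _ _ A); rewrite -sumrB -/D (absD A).
rewrite (eq_bigr D) => [|y]; last by rewrite inE => ?; rewrite ger0_norm.
rewrite [X in _ + X](eq_bigr (fun y => - D y)) => [|y]; last first.
  by rewrite inE -ltNge => /ltW ?; rewrite ler0_norm.
rewrite sumrN -sumD; apply: le_trans (ler_norm _).
by lra.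
Qed.

Lemma reversible_stationary (R : realType) (V : finType)
    (X : markov_chain R V) mu :
  is_distr mu -> reversible X mu -> stationary X mu.
Proof.
move=> dmu rX; split=> // t y; under eq_bigr do rewrite rX.
by rewrite -mulr_sumr step_sum1 mulr1.
Qed.

(** Autonomy speaks of indicators of events on B; a function of the
    coordinates in B is a combination of the indicators of the fibres of
    [restr B]. *)
Lemma autonomous_local (R : realType) (N : nat) (X : markov_chain R (cube N))
    (t : nat) (B : {set 'I_N}) (f : cube N -> R) :
  autonomous X -> local_to B f ->
  local_to B (fun x => \sum_y step X t x y * f y).
Proof.
move=> aX hf x x' e.
rewrite (partition_big (@restr N B) predT) //.
rewrite [RHS](partition_big (@restr N B) predT) //=.
apply: eq_bigr => u _.
have [[y0 /eqP y0u]|no_y] := pselect (exists y, restr B y == u); last first.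
  by rewrite !big_pred0 // => y; apply/negP => hy; apply: no_y; exists y.
have factor z : \sum_(y | restr B y == u) step X t z y * f y =
    (\sum_(y | restr B y \in [set u]%SET) step X t z y) * f y0.
  rewrite mulr_suml; apply: eq_big => [y|y /eqP yu]; first by rewrite inE.
  by rewrite (hf y y0) // yu y0u.
by rewrite !factor (aX _ _ _ _ _ e).
Qed.

(** * Chains that are diagonal in the eigenbasis *)

Section SpectralChains.
Context {R : realType} {N : nat} (p : R) (p01 : 0 < p < 1).
Context (X : markov_chain R (cube N)).
Implicit Types (A B : {set 'I_N}) (x y z : cube N).

Lemma bern_distr : is_distr (@bern R N p).
Proof.
split=> [x|]; first exact/ltW/bern_gt0.
have := walsh_orthogonal p01 finset.set0 (finset.set0 : {set 'I_N}).
rewrite eqxx /walsh_scale cards0 expr0 mul1r => h; rewrite -[RHS]h.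
by apply: eq_bigr => x _; rewrite walsh0 !mulr1.
Qed.

(** The image of [walsh B] has no component on [walsh A] for A not included in
    B, by autonomy on B, nor for B not included in A, by reversibility and
    autonomy on A. *)
Lemma autonomous_spectral t x y :
  reversible X (bern p) -> autonomous X ->
  step X t x y =
  spectral p (fun B => \sum_z step X t (cube0 N) z * walsh p B z) x y.
Proof.
move=> rX aX; move: x y; apply: (eigen_spectral p01) => B.
pose K A x := \sum_y step X t x y * walsh p A y.
have locK A : local_to A (K A).
  by apply: autonomous_local => //; exact: walsh_local.
have coef0 A : A != B -> \sum_y bern p y * K B y * walsh p A y = 0.
  rewrite finset.eqEsubset negb_and => /orP[h|h].
    exact: local_orthogonal (locK B) h.
  transitivity (\sum_y bern p y * K A y * walsh p B y); last first.
    exact: local_orthogonal (locK A) h.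
  (* The kernel is self-adjoint in L^2(bern p). *)
  rewrite /K; under eq_bigr do rewrite mulr_sumr mulr_suml.
  under [RHS]eq_bigr do rewrite mulr_sumr mulr_suml.
  rewrite exchange_big; apply: eq_bigr => y _; apply: eq_bigr => z _.
  rewrite [LHS](_ : _ = bern p z * step X t z y * (walsh p B y * walsh p A z)).
    by rewrite rX; ring.
  by ring.
have expand x : K B x = walsh_scale p B *
    (\sum_y bern p y * K B y * walsh p B y) * walsh p B x.
  rewrite [LHS](walsh_expansion p01) [LHS](bigD1 B) //= [X in _ + X]big1.
    by rewrite addr0.
  by move=> A /coef0 ->; rewrite mulr0 mul0r.
move=> x; rewrite -/(K B x) -/(K B (cube0 N)) [LHS]expand.
by rewrite [in RHS]expand walsh_cube0 mulr1.
Qed.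

Context (lam : nat -> {set 'I_N} -> R).
Context (X_lam : forall t x y, step X t x y = spectral p (lam t) x y).

Lemma trans_after_spectral s n x y :
  trans_after X s n x y =
  spectral p (fun B => \prod_(s <= k < s + n) lam k B) x y.
Proof.
elim: n y => [|n IHn] y /=.
  rewrite -(spectral1 p01); congr (_ * _); apply: eq_bigr => B _.
  by rewrite addn0 big_geq.
under eq_bigr do rewrite IHn X_lam.
rewrite spectral_comp //; congr (_ * _); apply: eq_bigr => B _.
by rewrite addnS big_nat_recr ?leq_addr.
Qed.

Lemma spectral_chain_reversible : reversible X (bern p).
Proof. by move=> t x y; rewrite !X_lam spectral_reversible. Qed.

Lemma spectral_chain_autonomous : autonomous X.
Proof.
move=> t B C x x' e.
pose f y : R := (restr B y \in C)%:R.
have hf : local_to B f by move=> y y' eB; rewrite /f eB.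
have sumf z : \sum_(y | restr B y \in C) step X t z y =
    \sum_y spectral p (lam t) z y * f y.
  rewrite big_mkcond; apply: eq_bigr => y _; rewrite X_lam /f.
  by case: ifP; rewrite ?mulr1 ?mulr0.
by rewrite !sumf; exact: (spectral_local p01 (lam t) hf).
Qed.

Lemma stationary_walsh nu t B : stationary X nu ->
  lam t B * (\sum_x nu x * walsh p B x) = \sum_x nu x * walsh p B x.
Proof.
move=> [_ snu].
rewrite -[RHS](eq_bigr _ (fun y _ => congr1 ( *%R^~ _) (snu t y))).
under [RHS]eq_bigr do rewrite mulr_suml.
rewrite exchange_big mulr_sumr; apply: eq_bigr => x _ /=.
under [RHS]eq_bigr do rewrite -mulrA X_lam.
by rewrite -mulr_sumr spectral_eigen // mulrCA.
Qed.

(** For p >= q the number theta lies in [-1, 0]. *)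
Lemma norm_walsh_le1 B x : 2^-1 <= p -> `|walsh p B x| <= 1.
Proof.
move=> p_ge; have /andP[p0 p1] := p01.
rewrite normr_prod; apply: prodr_ile1 => j _; rewrite normr_ge0 normrX /=.
have q_ge0 : 0 <= (1 - p) / p by rewrite divr_ge0 // ?subr_ge0 ltW.
apply: exprn_ile1 => //; rewrite normrN ger0_norm // ler_pdivrMr //.
by lra.
Qed.

(** A stationary nu is determined by its moments against the [walsh B], and
    [stationary_walsh] kills the moment at B once some eigenvalue at B differs
    from 1. If all of them equal 1, then [bern p] can be perturbed along
    [walsh B], and [norm_walsh_le1] keeps the perturbation nonnegative. *)
Lemma spectral_unique_stationary : 2^-1 <= p ->
  unique_stationary X (bern p) <->
  forall B, B != finset.set0 -> exists t, lam t B != 1.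
Proof.
move=> p_ge; have [bern_ge0 bern_sum] := bern_distr.
have bern_st := reversible_stationary bern_distr spectral_chain_reversible.
split=> [[_ uniq] B B0|moves].
  apply: contrapT => stuck.
  have lam1 t : lam t B = 1.
    by apply/eqP; apply: contrapT => /negP ?; apply: stuck; exists t.
  pose nu x := bern p x * (1 + walsh p B x).
  have st_nu : stationary X nu.
    split; first split.
    - move=> x; rewrite mulr_ge0 //.
      by have := norm_walsh_le1 B x p_ge; rewrite ler_norml => /andP[]; lra.
    - rewrite /nu; under eq_bigr do rewrite mulrDr mulr1.
      rewrite big_split /= bern_sum -[RHS]addr0; congr (_ + _).
      rewrite (eq_bigr (fun x => bern p x * 1 * walsh p B x)) => [|x _].
        apply: (@local_orthogonal _ _ _ p01 B finset.set0 (fun=> 1)) => //.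
        by rewrite finset.subset0.
      by rewrite mulr1.
    - move=> t y; rewrite /nu.
      under eq_bigr do
        rewrite mulrAC spectral_chain_reversible -mulrA mulrDr mulr1.
      rewrite -mulr_sumr big_split /= step_sum1; congr (_ * (_ + _)).
      under eq_bigr do rewrite X_lam.
      by rewrite spectral_eigen // lam1 mul1r.
  have := uniq nu st_nu (cube0 N); rewrite /nu walsh_cube0.
  by have := bern_gt0 p01 (cube0 N); lra.
split=> // nu st_nu y.
have nu0 B : B != finset.set0 -> \sum_x nu x * walsh p B x = 0.
  move=> /moves[t lt]; have := stationary_walsh t B st_nu.
  move/eqP; rewrite -subr_eq0 -{2}[\sum_x _]mul1r -mulrBl mulf_eq0.
  by rewrite subr_eq0 (negPf lt) => /eqP.
transitivity (\sum_x nu x * (x == y)%:R).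
  rewrite (bigD1 y) //= eqxx mulr1 big1 ?addr0 // => x /negPf ->.
  by rewrite mulr0.
under eq_bigr do rewrite -(walsh_complete p01) mulrCA mulr_sumr.
rewrite -mulr_sumr exchange_big (bigD1 finset.set0) //= [X in _ + X]big1.
  rewrite addr0 /walsh_scale cards0 expr0.
  under eq_bigr do rewrite !walsh0 !mulr1.
  by have [[_ ->] _] := st_nu; rewrite mulr1.
move=> B /nu0 B0.
transitivity (walsh_scale p B * walsh p B y * (\sum_x nu x * walsh p B x)).
  by rewrite mulr_sumr; apply: eq_bigr => x _; ring.
by rewrite B0 mulr0.
Qed.

End SpectralChains.

(** * Laws of the driving vectors *)

Local Open Scope classical_set_scope.
Local Open Scope ring_scope.

Section CubeVectorLaws.
Context {d : measure_display} {T : measurableType d} {R : realType}.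
Context (P : probability T R).

Lemma fine_expectation_finite (V : finType) (W : T -> V) (g : V -> R) :
  (forall v, measurable (W @^-1` [set v])) ->
  fine 'E_P[fun w => g (W w)] = \sum_v g v * fine (P (W @^-1` [set v])).
Proof.
move=> mW; rewrite unlock.
have decomp w : ((g (W w))%:E =
    \sum_v (g v)%:E * (\1_(W @^-1` [set v]) w)%:E)%E.
  under eq_bigr do rewrite -EFinM.
  rewrite sumEFin (bigD1 (W w)) //= indicE mem_set // mulr1 big1 ?addr0 //.
  move=> v /eqP vW; rewrite indicE memNset ?mulr0 // => /= e.
  by apply: vW; rewrite e.
under eq_integral do rewrite decomp.
rewrite integral_sum //; last first.
  by move=> v; apply: integrableZl => //; exact: integrable_indic.
rewrite (eq_bigr (fun v => (g v * fine (P (W @^-1` [set v])))%:E)) => [|v _].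
  by rewrite sumEFin.
rewrite integralZl //; last exact: integrable_indic.
rewrite integral_indic // setIT EFinM fineK //.
exact: fin_num_measure.
Qed.

Context {N : nat}.
Implicit Types (Z : nat -> {RV P >-> cube N}) (x y z : cube N).
Implicit Types B : {set 'I_N}.

Definition pmass Z k z : R := fine (P (Z k @^-1` [set z])).

Lemma fine_expectation_vector Z k (g : cube N -> R) :
  fine 'E_P[fun w => g (Z k w)] = \sum_z g z * pmass Z k z.
Proof.
apply: fine_expectation_finite => z; rewrite -[X in measurable X]setTI.
exact: measurable_funP.
Qed.

Lemma sum_pmass Z k : \sum_z pmass Z k z = 1.
Proof.
transitivity (\sum_z 1 * pmass Z k z).
  by apply: eq_bigr => z _; rewrite mul1r.
by rewrite -(fine_expectation_vector Z k (fun=> 1)) expectation_cst.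
Qed.

(** The vectors Z_{s+1}, ..., Z_{s+n}, packed as one random element of a finite
    type: expectations of functions of them become finite sums. *)
Definition window Z s n (w : T) : {ffun 'I_n -> cube N} :=
  [ffun k : 'I_n => Z (k + s.+1)%N w].

Lemma window_measurable Z s n (F : {ffun 'I_n -> cube N}) :
  measurable (window Z s n @^-1` [set F]).
Proof.
rewrite (_ : _ @^-1` _ =
    \bigcap_(k in [set: 'I_n]) (Z (k + s.+1)%N @^-1` [set F k])).
  apply: fin_bigcap_measurable => // k _.
  by rewrite -[X in measurable X]setTI; exact: measurable_funP.
apply/seteqP; split=> w /=; first by move=> <- k _; rewrite ffunE.
by move=> h; apply/ffunP => k; rewrite ffunE h.
Qed.

Lemma joint_pmass Z s n (F : {ffun 'I_n -> cube N}) : independent_vectors Z ->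
  fine (P (window Z s n @^-1` [set F])) =
  \prod_(k < n) pmass Z (k + s.+1) (F k).
Proof.
move=> hZ.
(* The event attached to the index i is the singleton F k when i = k + s + 1,
   and it is stated for all i since the independence is indexed by nat. *)
pose A i : set (cube N) :=
  [set z | forall k : 'I_n, (k + s.+1)%N = i -> z = F k].
pose J := [seq (k + s.+1)%N | k : 'I_n <- index_enum 'I_n].
have AE (k : 'I_n) : A (k + s.+1)%N = [set F k].
  apply/seteqP; split=> [z|z -> k' /addIn e]; first exact.
  by congr (F _); apply: val_inj.
have := hZ J A _ _ _.
rewrite (_ : \bigcap_(i in _) _ =
    window Z s n @^-1` [set F]); last first.
  apply/seteqP; split=> w /= h.
    apply/ffunP => k; rewrite ffunE; apply: (h (k + s.+1)%N) => //=.
    by apply: (map_f (fun k : 'I_n => k + s.+1)%N); rewrite mem_index_enum.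
  by move=> i _ k <-; rewrite -h ffunE.
move=> ->.
- rewrite big_map.
  rewrite (eq_bigr (fun k : 'I_n => (pmass Z (k + s.+1) (F k))%:E)) => [|k _].
    by rewrite prodEFin.
  rewrite AE /pmass fineK //; apply: fin_num_measure.
  by rewrite -[X in measurable X]setTI; exact: measurable_funP.
- by rewrite map_inj_uniq ?index_enum_uniq // => i j /addIn /val_inj.
- by move=> i /= /mapP[k _ ->]; rewrite addnS.
- by [].
Qed.

Section WithParameter.
Context (p : R) (p01 : 0 < p < 1).

(** The mean of [walsh p B (Z k)], by [fine_expectation_vector]; it is the
    eigenvalue at [walsh p B] of the step driven by [Z k]. *)
Definition vec_eigen Z k B : R := \sum_z walsh p B z * pmass Z k z.

Lemma vec_eigen0 Z k : vec_eigen Z k finset.set0 = 1.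
Proof.
rewrite -[RHS](sum_pmass Z k); apply: eq_bigr => z _.
by rewrite walsh0 mul1r.
Qed.

(** Since [- theta^-1 = p / (1 - p)], each factor is 1 plus a product of powers
    of theta, and expanding the product over j produces the sum over B. *)
Lemma prod_walsh_expansion x y n (F : {ffun 'I_n -> cube N}) :
  \prod_(j < N) (1 - (- ((1 - p) / p)) ^
    ((coord x j)%:Z + (coord y j)%:Z - 1 + \sum_(k < n) (coord (F k) j)%:Z)) =
  \sum_B walsh_scale p B * walsh p B x * walsh p B y
    * \prod_(k < n) walsh p B (F k).
Proof.
have [p0 p1] := andP p01.
have pn0 : p != 0 by rewrite gt_eqF.
have qn0 : 1 - p != 0 by rewrite gt_eqF // subr_gt0.
have tn0 : theta p != 0 by rewrite oppr_eq0 mulf_neq0 ?invr_eq0.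
transitivity (\prod_(j < N) (p / (1 - p) * theta p ^+ coord x j
    * theta p ^+ coord y j * \prod_(k < n) theta p ^+ coord (F k) j + 1)).
  apply: eq_bigr => j _; rewrite -/(theta p).
  rewrite -(big_morph Posz PoszD (erefl _)) !expfzDr // -!exprnP exprN1.
  rewrite (big_morph (fun m => theta p ^+ m) (exprD _) (expr0 _)) addrC.
  congr (_ + _); rewrite [in X in - (_ * X * _)]/theta.
  by field; rewrite ?pn0 ?qn0.
rewrite bigA_distr; apply: eq_big => [B|B _]; first by rewrite inE.
rewrite -big_mkcond /walsh_scale -prodr_const [in RHS]exchange_big.
by rewrite -!big_split.
Qed.

(** Up to the factor [bern p y], the expectation is a kernel that is diagonal in
    the eigenbasis; independence is what makes its eigenvalues products. *)
Lemma EprodE Z s n x y : independent_vectors Z ->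
  Eprod p Z s (s + n) x y =
  \sum_B (\prod_(s <= k < s + n) vec_eigen Z k.+1 B) * walsh_scale p B
    * walsh p B x * walsh p B y.
Proof.
move=> hZ.
pose g (F : {ffun 'I_n -> cube N}) := \sum_B walsh_scale p B * walsh p B x
  * walsh p B y * \prod_(k < n) walsh p B (F k).
have -> : Eprod p Z s (s + n) x y = fine 'E_P[fun w => g (window Z s n w)].
  congr (fine 'E_P[_]); apply/funext => w; rewrite /g -prod_walsh_expansion.
  apply: eq_bigr => j _; rewrite /Sexp -[s.+1]add0n big_addn big_mkord.
  rewrite subSS addKn; congr (1 - _ ^ (_ + _)).
  by apply: eq_bigr => k _; rewrite ffunE.
rewrite fine_expectation_finite; last exact: window_measurable.
under eq_bigr do rewrite joint_pmass // mulr_suml.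
rewrite exchange_big; apply: eq_bigr => B _ /=.
under eq_bigr do rewrite -mulrA -big_split /=.
(* A sum over all F of a product over k is a product of sums. *)
rewrite -mulr_sumr -(bigA_distr_bigA
  (fun (k : 'I_n) z => walsh p B z * pmass Z (k + s.+1) z)).
have -> : \prod_(s <= k < s + n) vec_eigen Z k.+1 B =
    \prod_(k < n) vec_eigen Z (k + s.+1) B.
  rewrite -{1}[s]add0n big_addn big_mkord addKn.
  by apply: eq_bigr => k _; rewrite addnS.
by rewrite /vec_eigen; ring.
Qed.

(** With a single driving vector the exponent is one of -1, 0, 1, 2, and
    [1 - theta ^ e] is nonnegative for each of them; only e = 2 requires
    |theta| <= 1. *)
Lemma Eprod1_ge0 Z t x y : 2^-1 <= p -> 0 <= Eprod p Z t t.+1 x y.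
Proof.
move=> p_ge; have [p0 p1] := andP p01.
apply/fine_ge0/expectation_ge0 => w; apply: prodr_ge0 => j _.
rewrite /Sexp big_nat1.
have r_ge0 : 0 <= (1 - p) / p by rewrite divr_ge0 // ?subr_ge0 ltW.
have r_le1 : (1 - p) / p <= 1 by rewrite ler_pdivrMr //; lra.
set r := (1 - p) / p in r_ge0 r_le1 *; set e : int := _ + _.
have : [\/ e = -1, e = 0, e = 1 | e = 2].
  rewrite /e; case: (coord x j) (coord y j) (coord (Z _ _) j) => -[] [];
    by [apply: Or41|apply: Or42|apply: Or43|apply: Or44].
case=> ->.
- by rewrite exprN1 invrN opprK addr_ge0 // invr_ge0.
- by rewrite expr0z subrr.
- by rewrite expr1z opprK addr_ge0.
- by rewrite -exprnP sqrrN subr_ge0 exprn_ile1.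
Qed.

End WithParameter.
End CubeVectorLaws.

(** * The transition formula and its converse *)

Theorem theorem3p16 (R : realType) (N : nat) (p : R)
    (d : measure_display) (T : measurableType d) (P : probability T R)
    (Z : nat -> {RV P >-> cube N}) (hZ : independent_vectors Z) :
  (forall X : markov_chain R (cube N),
     class_G X p -> associated X Z ->
     forall (t : nat) (x : cube N), (1 <= t)%N ->
       (forall y : cube N,
          trans X 0 t x y = bern p y * Eprod p Z 0 t x y) /\
       tv_dist (trans X 0 t x) (bern p) =
         2^-1 * \sum_(y : cube N) bern p y * `|Eprod p Z 0 t x y - 1|) /\
  (2^-1 <= p < 1 ->
     exists X : markov_chain R (cube N),
       [/\ forall (s t : nat) (x y : cube N), (s < t)%N ->
             trans X s t x y = bern p y * Eprod p Z s t x y,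
           stationary X (bern p),
           reversible X (bern p),
           autonomous X
         & class_G X p <-> moving_vectors p Z]).
Proof.
split=> [X [p_half _ rX aX] assoc t x t_ge1|p_half].
  have p01 : 0 < p < 1 by lra.
  have stepE s u v : step X s u v = spectral p (vec_eigen p Z s.+1) u v.
    rewrite (autonomous_spectral p01) //; congr (_ * _); apply: eq_bigr => B _.
    congr (_ * _ * _ * _); apply: eq_bigr => z _; rewrite mulrC; congr (_ * _).
    have := assoc s [set z]%SET; rewrite big_set1.
    have -> : [set` [set z]%SET] = [set z].
      by apply/seteqP; split=> v' /=; rewrite inE => /eqP.
    by rewrite /pmass => ->.
  have transE y : trans X 0 t x y = bern p y * Eprod p Z 0 t x y.
    rewrite /trans subn0 (trans_after_spectral p01 stepE).
    by rewrite -[in RHS](add0n t) EprodE.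
  split=> //.
  have [_ bern_sum] := bern_distr (N := N) p01.
  rewrite tv_dist_half_sum; last first.
    rewrite bern_sum /trans subn0.
    under eq_bigr do rewrite (trans_after_spectral p01 stepE).
    by apply: spectral_sum1 => //; rewrite big1 // => k _; exact: vec_eigen0.
  congr (_ * _); apply: eq_bigr => y _; rewrite transE.
  by rewrite -{2}[bern p y]mulr1 -mulrBr normrM gtr0_norm ?bern_gt0.
have p01 : 0 < p < 1 by lra.
have /andP[p_ge _] := p_half.
pose K t x y := bern p y * Eprod p Z t t.+1 x y.
have KE t x y : K t x y = spectral p (vec_eigen p Z t.+1) x y.
  rewrite /K -addn1 EprodE //; congr (_ * _); apply: eq_bigr => B _.
  by rewrite addn1 big_nat1.
have K_ge0 t x y : 0 <= K t x y.
  by rewrite mulr_ge0 ?Eprod1_ge0 // ltW // bern_gt0.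
have K_sum1 t x : \sum_y K t x y = 1.
  by under eq_bigr do rewrite KE; rewrite spectral_sum1 // vec_eigen0.
exists (MarkovChain K_ge0 K_sum1).
set X := MarkovChain _ _; have stepE t x y : step X t x y = _ := KE t x y.
have rX := spectral_chain_reversible stepE.
have aX := spectral_chain_autonomous p01 stepE.
split=> //.
- move=> s t x y st; rewrite /trans (trans_after_spectral p01 stepE).
  by rewrite -[in RHS](subnKC (ltnW st)) EprodE.
- exact: reversible_stationary (bern_distr p01) rX.
have movingE : moving_vectors p Z <->
    forall B, B != finset.set0 -> exists t, vec_eigen p Z t.+1 B != 1.
  have eigenE t (B : {set _}) : fine 'E_P[fun w => \prod_(j in B)
      (- ((1 - p) / p)) ^+ coord (Z t w) j] = vec_eigen p Z t B.
    exact: fine_expectation_vector.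
  split=> h B /h[t].
    by case: t => [|t] [] // _; rewrite eigenE => ?; exists t.
  by move=> ?; exists t.+1; split=> //; rewrite eigenE.
rewrite movingE -(spectral_unique_stationary p01 stepE p_ge).
by split=> [[]|].
Qed.
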